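(* Let $\Bbbk$ be an algebraically closed field of characteristic zero. Let $r,s,a,b$ be positive integers with $a\le b$, $r\ge s$, $d=\gcd(r,s)$, and let $\lambda=p/q>0$ in lowest terms, such that \[ B=\begin{bmatrix} r & s\\ -\lambda r & -\lambda s\\ a & b\end{bmatrix} \] is an integer matrix of rank $2$. Let $I(B)=\langle x^rz^a-y^{\lambda r},\ x^sz^b-y^{\lambda s}\rangle\subseteq \Bbbk[x,y,z]$. Then the primary component of $I(B)$ corresponding to the associated prime $\langle x,y\rangle$ is \[ (I(B):z^\infty)+\big\langle y^{\lambda(r+s-d)},\ x^dy^{\lambda(r+s-2d)},\ x^{2d}y^{\lambda(r+s-3d)},\ \dots,\ x^{r+s-d}\big\rangle . \]
   Context: $(I:z^\infty)$ denotes the saturation $\{g\in\Bbbk[x,y,z]\mid z^m g\in I \text{ for some } m\ge 0\}$. *)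

(* Defs.v *)
From HB Require Import structures.
From mathcomp Require Import all_boot all_order all_algebra.
From mathcomp Require Export mpoly.
Set Implicit Arguments. Unset Strict Implicit. Unset Printing Implicit Defensive.
Import Order.TTheory GRing.Theory Num.Theory.
Local Open Scope ring_scope.

Section Ideals.
Variable R : comNzRingType.

Definition ideal_of := R -> Prop.

Definition ideal_eq (I J : ideal_of) : Prop := forall f, I f <-> J f.

Definition is_ideal (I : ideal_of) : Prop :=
  [/\ I 0, (forall f g, I f -> I g -> I (f + g)) & (forall c f, I f -> I (c * f))].

Definition ideal_gen (gs : seq R) : ideal_of :=
  fun f => exists c : 'I_(size gs) -> R, f = \sum_(i < size gs) c i * gs`_i.

Definition ideal_add (I J : ideal_of) : ideal_of :=
  fun f => exists g h, [/\ I g, J h & f = g + h].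

Definition saturation (I : ideal_of) (z : R) : ideal_of :=
  fun g => exists m : nat, I (z ^+ m * g).

Definition radical (I : ideal_of) : ideal_of :=
  fun f => exists n : nat, I (f ^+ n).

Definition primary (Q : ideal_of) : Prop :=
  [/\ is_ideal Q, ~ Q 1 &
      forall f g, Q (f * g) -> Q f \/ radical Q g].

(* Q is the P-primary component of I: Q is primary with radical P and
   appears in a primary decomposition I = Q ∩ Q_1 ∩ ... ∩ Q_n where no
   other component has radical P, and Q is not redundant (so P is an
   associated prime of I). *)
Definition primary_component_of (I P Q : ideal_of) : Prop :=
  [/\ primary Q, ideal_eq (radical Q) P &
      exists (n : nat) (Qs : 'I_n -> ideal_of),
        [/\ forall i, primary (Qs i) /\ ~ ideal_eq (radical (Qs i)) P,
            ideal_eq I (fun f => Q f /\ forall i, Qs i f) &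
            ~ ideal_eq I (fun f => forall i, Qs i f)]].

End Ideals.

Definition Bmat (r s a b : nat) (lam : rat) : 'M[rat]_(3, 2) :=
  \matrix_(i < 3, j < 2)
    nth 0 (nth [::] [:: [:: r%:R; s%:R];
                        [:: - (lam * r%:R); - (lam * s%:R)];
                        [:: a%:R; b%:R]] i) j.

(* Main.v *)
Require Import Defs.
From HB Require Import structures.
From mathcomp Require Import all_boot all_order all_algebra.
From mathcomp Require Import mpoly zify ring.
From Stdlib Require Import ClassicalEpsilon FunctionalExtensionality PropExtensionality.
Set Implicit Arguments. Unset Strict Implicit. Unset Printing Implicit Defensive.
Import Order.TTheory GRing.Theory Num.Theory.
Local Open Scope ring_scope.

(* Write d = gcd(r, s), r = d p, s = d q, X = x^d and Y = y^l with l = lambda d, so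
   that I = I(B) is generated by X^p z^a - Y^p and X^q z^b - Y^q, which are
   homogeneous in X, Y. Rank 2 means a q <> b p. As P = <x, y> is minimal over I, its
   primary component is {f | u f in I for some u not in P}; it has to be compared
   with J = (I : z^oo) + <X, Y>^(p + q - 1).

   Degree p + q - 1: the two generators shift the monomials X^i Y^(p+q-1-i)
   cyclically by i -> i + q mod p + q, up to powers of z. Going once around the cycle
   gives (z^(a q) - z^(b p)) X^i Y^(p+q-1-i) in I, whose first factor is not in P.

   Lower degrees: modulo <X, Y>^(p+q-1), a multiplier u outside P may be replaced by
   a power of its constant term c(z), and then by the part of c prime to z, after
   saturating. If c f = A (X^p z^a - Y^p) + B (X^q z^b - Y^q) in degree n < p + q - 1,
   the coefficient equations form the same cycle with at least one edge missing, which
   forces c to divide A and B; hence f is in I. *)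

(** * Ideals, primary decomposition in noetherian rings, and isolated components *)

Section Ideal.
Variable R : comNzRingType.
Implicit Types (I J P Q : ideal_of R) (f g : R) (gs : seq R).

Lemma ideal0 I : is_ideal I -> I 0. Proof. by case. Qed.

Lemma idealD I f g : is_ideal I -> I f -> I g -> I (f + g).
Proof. by case=> _ ID _; exact: ID. Qed.

Lemma idealM I c f : is_ideal I -> I f -> I (c * f).
Proof. by case=> _ _; apply. Qed.

Lemma idealB I f g : is_ideal I -> I f -> I g -> I (f - g).
Proof. by move=> idI If Ig; apply: idealD => //; rewrite -mulN1r; apply: idealM. Qed.

Lemma ideal_sum I (n : nat) (F : 'I_n -> R) :
  is_ideal I -> (forall i, I (F i)) -> I (\sum_(i < n) F i).
Proof. by case=> I0 ID _ IF; apply: (big_ind I). Qed.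

Lemma ideal_gen_ideal gs : is_ideal (ideal_gen gs).
Proof.
split.
- by exists (fun=> 0); rewrite big1 // => i _; rewrite mul0r.
- move=> f g [c ->] [c' ->]; exists (fun i => c i + c' i).
  by rewrite -big_split; apply: eq_bigr => i _; rewrite mulrDl.
- move=> a f [c ->]; exists (fun i => a * c i).
  by rewrite mulr_sumr; apply: eq_bigr => i _; rewrite mulrA.
Qed.

Lemma mem_ideal_gen gs f : f \in gs -> ideal_gen gs f.
Proof.
move=> fgs; have lt := fgs; rewrite -index_mem in lt.
exists (fun i => (i == Ordinal lt)%:R).
rewrite (bigD1 (Ordinal lt)) //= eqxx mul1r nth_index // big1 ?addr0 // => i.
by move/negPf->; rewrite mul0r.
Qed.

Lemma ideal_gen_sub I gs :
  is_ideal I -> {in gs, forall g, I g} -> forall f, ideal_gen gs f -> I f.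
Proof.
move=> idI Igs f [c ->]; apply: ideal_sum => // i.
by case: idI => _ _; apply; apply: Igs; apply: mem_nth.
Qed.

Lemma ideal_gen2P g1 g2 f :
  ideal_gen [:: g1; g2] f <-> exists c1 c2, f = c1 * g1 + c2 * g2.
Proof.
split=> [[c ->]|[c1 [c2 ->]]].
  exists (c ord0), (c ord_max); rewrite big_ord_recl big_ord1 /=.
  by congr (_ + c _ * _); apply: val_inj.
have [_ genD genM] := ideal_gen_ideal [:: g1; g2].
by apply: genD; apply: genM; apply: mem_ideal_gen; rewrite !inE eqxx ?orbT.
Qed.

Lemma ideal_add_ideal I J : is_ideal I -> is_ideal J -> is_ideal (ideal_add I J).
Proof.
move=> idI idJ; split.
- by exists 0, 0; split; [apply: ideal0 | apply: ideal0 | rewrite addr0].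
- move=> _ _ [g [h [Ig Jh ->]]] [g' [h' [Ig' Jh' ->]]].
  by exists (g + g'), (h + h'); split; [apply: idealD | apply: idealD | rewrite addrACA].
- move=> c _ [g [h [Ig Jh ->]]]; exists (c * g), (c * h).
  by split; [apply: idealM | apply: idealM | rewrite mulrDr].
Qed.

Lemma saturation_ideal I z : is_ideal I -> is_ideal (saturation I z).
Proof.
move=> idI; split.
- by exists 0%N; rewrite mulr0; apply: ideal0.
- move=> f g [m If] [n Ig]; exists (m + n)%N; rewrite mulrDr; apply: idealD => //.
    by rewrite addnC exprD -mulrA; apply: idealM.
  by rewrite exprD -mulrA; apply: idealM.
- by move=> c f [m If]; exists m; rewrite mulrCA; apply: idealM.
Qed.

Lemma radical_ideal I : is_ideal I -> is_ideal (radical I).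
Proof.
move=> idI; split.
- by exists 1%N; apply: ideal0.
- move=> f g [m If] [n Ig]; exists (m + n)%N.
  rewrite exprDn; apply: (ideal_sum idI) => i.
  rewrite -mulr_natl; apply: idealM => //.
  case: (leqP n i) => [lni|lin].
    by apply: idealM => //; rewrite -(subnK lni) exprD; apply: idealM.
  rewrite mulrC; apply: idealM => //; have -> : (m + n - i = (n - i) + m)%N by lia.
  by rewrite exprD; apply: idealM.
- by move=> c f [m If]; exists m; rewrite exprMn; apply: idealM.
Qed.

Definition noetherian := forall I : nat -> ideal_of R,
  (forall n, is_ideal (I n)) -> (forall n f, I n f -> I n.+1 f) ->
  exists n, forall m f, I m f -> I n f.

Lemma chain_mono (I : nat -> ideal_of R) :
  (forall n f, I n f -> I n.+1 f) ->
  forall m n f, (m <= n)%N -> I m f -> I n f.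
Proof.
move=> incI m n f /subnKC <-; elim: (n - m)%N => [|k IHk] Imf; rewrite ?addn0 //.
by rewrite addnS; apply/incI/IHk.
Qed.

(** The family may be empty, which accounts for the unit ideal, and radicals may repeat. *)
Definition primary_meet I := exists (n : nat) (Qs : 'I_n -> ideal_of R),
  (forall i, primary (Qs i)) /\ ideal_eq I (fun f => forall i, Qs i f).

Lemma primary_meetI I J K : primary_meet J -> primary_meet K ->
  ideal_eq I (fun f => J f /\ K f) -> primary_meet I.
Proof.
move=> [m [Qs [prQ JE]]] [n [Qs' [prQ' KE]]] IE.
exists (m + n)%N, (fun i => match split i with inl j => Qs j | inr j => Qs' j end).
split=> [i|f]; first by case: split.
split=> [/IE[/JE Jf /KE Kf] i|Af]; first by case: split.
apply/IE; split; [apply/JE => i; have := Af (unsplit (inl i))|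
  apply/KE => i; have := Af (unsplit (inr i))]; by rewrite unsplitK.
Qed.

Lemma not_primary I : is_ideal I -> ~ I 1 -> ~ primary I ->
  exists f g, [/\ I (f * g), ~ I f & ~ radical I g].
Proof.
move=> idI I1 nprI; apply: NNPP => nfg; apply: nprI; split=> // f g Ifg.
apply: NNPP => /not_or_and[nIf nIg]; apply: nfg.
by exists f, g.
Qed.

Definition adjoin I h : ideal_of R := ideal_add I (ideal_gen [:: h]).

Lemma adjoinP I h f : adjoin I h f <-> exists i a, I i /\ f = i + a * h.
Proof.
split=> [[i [_ [Ii [c ->] ->]]]|[i [a [Ii ->]]]].
  by exists i, (c ord0); rewrite big_ord1.
exists i, (a * h); split=> //.
by exists (fun=> a); rewrite big_ord1.
Qed.

Lemma adjoin_ideal I h : is_ideal I -> is_ideal (adjoin I h).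
Proof. by move=> idI; apply: ideal_add_ideal => //; apply: ideal_gen_ideal. Qed.

Lemma sub_adjoin I h f : I f -> adjoin I h f.
Proof. by move=> If; apply/adjoinP; exists f, 0; rewrite mul0r addr0. Qed.

Lemma mem_adjoin I h : is_ideal I -> adjoin I h h.
Proof. by move=> idI; apply/adjoinP; exists 0, 1; rewrite mul1r add0r; split=> //; apply: ideal0. Qed.

(** The colon ideals [(I : g^n)] stabilise at some [n], and [h = g^n] for that [n]; this is the
    classical argument that irreducible ideals are primary. *)
Lemma noetherian_not_primary I f g : noetherian -> is_ideal I ->
  I (f * g) -> ~ radical I g ->
  exists h, ~ I h /\ ideal_eq I (fun k => adjoin I f k /\ adjoin I h k).
Proof.
move=> noethR idI Ifg nIg.
pose C n : ideal_of R := fun a => I (a * g ^+ n).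
have idC n : is_ideal (C n).
  split=> [|a b Ia Ib|c a Ia]; rewrite /C ?mul0r ?mulrDl -?mulrA;
    [exact: ideal0 | exact: idealD | exact: idealM].
have incC n a : C n a -> C n.+1 a.
  by rewrite /C exprS mulrCA; apply: idealM.
have [n stabC] := noethR C idC incC.
exists (g ^+ n); split=> [Ign|k]; first by apply: nIg; exists n.
split=> [Ik|[/adjoinP[i [a [Ii ->]]] /adjoinP[j [b [Ij E]]]]].
  by split; apply: sub_adjoin.
(* [k = j + b g^n] lies in [(I, f)] and [f g] in [I], so [b g^(n+1)] is in [I]; stability then puts
   [b g^n] in [I]. *)
rewrite E; apply: idealD => //; apply: (stabC n.+1).
rewrite /C exprS mulrCA; have -> : b * g ^+ n = i + a * f - j by rewrite E; ring.
have -> : g * (i + a * f - j) = g * i + a * (f * g) - g * j by ring.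
by apply: idealB => //; [apply: idealD => //; apply: idealM | apply: idealM].
Qed.

(* Lasker-Noether. *)
Lemma noetherian_primary_meet I : noetherian -> is_ideal I -> primary_meet I.
Proof.
move=> noethR idI; apply: NNPP => badI.
pose bad := {J : ideal_of R | is_ideal J /\ ~ primary_meet J}.
(* Every bad ideal lies strictly inside another bad one; choice turns this into an infinite strictly
   ascending chain. *)
have next (J : bad) : exists J' : bad, (forall f, sval J f -> sval J' f)
    /\ exists f, sval J' f /\ ~ sval J f.
  case: J => J [idJ badJ] /=.
  have J1 : ~ J 1.
    move=> J1; apply: badJ; exists 0%N, (fun=> J); split=> [[]|f] //.
    by split=> // _; rewrite -[f]mulr1; case: idJ => _ _; apply.
  have nprJ : ~ primary J.
    by move=> prJ; apply: badJ; exists 1%N, (fun=> J); split=> // f; split=> // /(_ ord0).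
  have [f [g [Jfg nJf nJg]]] := not_primary idJ J1 nprJ.
  have [h [nJh JE]] := noetherian_not_primary noethR idJ Jfg nJg.
  have ext k : ~ J k -> ~ primary_meet (adjoin J k) -> exists J' : bad,
      (forall f, J f -> sval J' f) /\ exists f, sval J' f /\ ~ J f.
    move=> nJk badk; exists (exist _ (adjoin J k) (conj (adjoin_ideal k idJ) badk)).
    by split=> /= [f'|]; [apply: sub_adjoin | exists k; split=> //; apply: mem_adjoin].
  case: (classic (primary_meet (adjoin J f))) => [pmf|]; last exact: ext.
  case: (classic (primary_meet (adjoin J h))) => [pmh|]; last exact: ext.
  by case: badJ; apply: primary_meetI pmf pmh JE.
pose nxt (J : bad) := proj1_sig (constructive_indefinite_description _ (next J)).
have nxtP (J : bad) := proj2_sig (constructive_indefinite_description _ (next J)).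
pose I_ n := iter n nxt (exist _ I (conj idI badI) : bad).
have [||n stab] := noethR (fun n => sval (I_ n)).
- by move=> n; case: (proj2_sig (I_ n)).
- by move=> n; case: (nxtP (I_ n)).
by have [_ [f [If nIf]]] := nxtP (I_ n); apply/nIf/(stab n.+1).
Qed.

Definition prime_ideal P :=
  [/\ is_ideal P, ~ P 1 & forall f g, P (f * g) -> P f \/ P g].

Lemma prime_ideal_exp P f n : prime_ideal P -> P (f ^+ n) -> P f.
Proof.
case=> _ P1 PM; elim: n => [|n IHn]; rewrite ?expr0 // exprS.
by case/PM.
Qed.

(* [Q] is the contraction of [I] localised at [P]; that it contains a power of
   each element of [P] expresses the minimality of [P] over [I]. *)
Lemma localization_primary_component I P Q : noetherian -> is_ideal I ->
  prime_ideal P -> (forall f, I f -> P f) ->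
  (forall f, Q f <-> exists u, ~ P u /\ I (u * f)) ->
  (forall f, P f -> radical Q f) ->
  primary_component_of I P Q.
Proof.
move=> noethR idI primeP IP QE radQ.
have [idP P1 PM] := primeP; 
have notPM u v : ~ P u -> ~ P v -> ~ P (u * v) by move=> ? ? /PM[].
have IQ f : I f -> Q f by move=> If; apply/QE; exists 1; rewrite mul1r.
have QP f : Q f -> P f by case/QE=> u [Pu /IP/PM[]].
have idQ : is_ideal Q.
  split; first by apply: IQ; apply: ideal0.
  - move=> f g /QE[u [Pu If]] /QE[v [Pv Ig]]; apply/QE; exists (u * v).
    split; first exact: notPM.
    have -> : u * v * (f + g) = v * (u * f) + u * (v * g) by ring.
    by apply: idealD => //; apply: idealM.
  - move=> c f /QE[u [Pu If]]; apply/QE; exists u; split=> //.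
    by rewrite mulrCA; apply: idealM.
have radQP f : radical Q f <-> P f.
  by split=> [[n /QP/prime_ideal_exp]|]; [apply | apply: radQ].
split=> //.
  split=> [//|/QP//|f g /QE[u [Pu Iufg]]].
  case: (classic (P g)) => [/radQ|Pg]; [by right | left].
  by apply/QE; exists (u * g); split; [apply: notPM | rewrite mulrAC -mulrA].
have [n [Qs [prQs IE]]] := noetherian_primary_meet noethR idI.
(* A component inside [P] has radical [P]: for [f] in [P] some [u f^k] is in [I] with [u] outside
   [P], hence outside the radical of the component, which therefore contains [f^k]. *)
have Qs_u i : ~ ideal_eq (radical (Qs i)) P -> exists u, ~ P u /\ Qs i u.
  move=> radQi; have [idQi Qi1 QiM] := prQs i.
  have IQi f : I f -> Qs i f by move/IE; apply.
  apply: NNPP => nu; have QiP f : radical (Qs i) f -> P f.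
    case=> k Qif; apply: (prime_ideal_exp (n := k)) => //; apply: NNPP => Pf.
    by apply: nu; exists (f ^+ k).
  apply: radQi => f; split=> [/QiP //|/radQ[k /QE[u [Pu Iuf]]]].
  have := IQi _ Iuf; rewrite mulrC => /QiM[Qif|/QiP //].
  by exists k.
(* [Q] replaces all components of radical [P]; [A] indexes those that are kept. *)
pose A i := if excluded_middle_informative (ideal_eq (radical (Qs i)) P)
  then false else true.
have AP i : reflect (~ ideal_eq (radical (Qs i)) P) (A i).
  by rewrite /A; case: excluded_middle_informative => ?; constructor.
(* A product of elements outside [P], one from each kept component; it shows at the end that [Q] is
   not redundant. *)
have [u [Pu Qsu]] : exists u, ~ P u /\ forall i, A i -> Qs i u.
  suff [u [Pu Qsu]] : exists u, ~ P u /\ forall i, i \in enum A -> Qs i u.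
    by exists u; split=> // i Ai; apply: Qsu; rewrite mem_enum.
  have : forall i, i \in enum A -> A i by move=> i; rewrite mem_enum.
  elim: (enum A) => [|i l IHl] lA; first by exists 1.
  have [|u [Pu Qsu]] := IHl; first by move=> j jl; apply: lA; rewrite inE jl orbT.
  have [|v [Pv Qsv]] := Qs_u i; first by apply/AP/lA; rewrite inE eqxx.
  exists (u * v); split=> [|j]; first exact: notPM.
  have [idQj _ _] := prQs j; rewrite inE => /predU1P[->|/Qsu Qju].
    by apply: idealM => //; case: (prQs i).
  by rewrite mulrC; apply: idealM.
exists #|A|, (fun i => Qs (enum_val i)); split=> [i|f|eqI].
- by split=> //; apply/AP/(enum_valP i).
- split=> [If|[/QE[v [Pv Ivf]] Qsf]].
    by split=> [|i]; [apply: IQ | case: (IE f) => /(_ If)].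
  apply/IE => i; case: (boolP (A i)) => [Ai|/AP/NNPP radQi].
    by have := Qsf (enum_rank_in Ai i); rewrite enum_rankK_in.
  (* A dropped component contains [v f], and [v] is outside its radical [P], so it contains [f]. *)
  have [_ _ QiM] := prQs i; have /IE/(_ i) := Ivf.
  by rewrite mulrC => /QiM[//|/radQi].
- by apply/Pu/IP/eqI => i; apply/Qsu/(enum_valP i).
Qed.
End Ideal.

(** * Hilbert's basis theorem *)

Lemma field_noetherian (F : fieldType) : noetherian F.
Proof.
move=> I idI incI; case: (classic (exists n c, I n c /\ c != 0)).
  case=> n [c [Inc c0]]; exists n => _ f _.
  by rewrite -[f](divfK c0); apply: idealM.
move=> nI; exists 0%N => m f Imf; case: (eqVneq f 0) => [->|f0].
  exact: ideal0.
by case: nI; exists m, f.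
Qed.

Section HilbertBasis.
Variables (R : comNzRingType).

(** Leading coefficients of the members of degree [k], together with zero: bounding the size instead
    of fixing it makes this an ideal. *)
Definition coef_ideal (J : ideal_of {poly R}) (k : nat) : ideal_of R :=
  fun c => exists f, [/\ J f, (size f <= k.+1)%N & f`_k = c].

Lemma coef_ideal_ideal J k : is_ideal J -> is_ideal (coef_ideal J k).
Proof.
move=> idJ; split.
- by exists 0; rewrite size_poly0 coef0; split=> //; apply: ideal0.
- move=> _ _ [f [Jf szf <-]] [g [Jg szg <-]]; exists (f + g).
  split; [exact: idealD | | by rewrite coefD].
  by rewrite (leq_trans (size_polyD _ _)) // geq_max szf.
- move=> c _ [f [Jf szf <-]]; exists (c%:P * f).
  split; [exact: idealM | | by rewrite coefCM].
  by rewrite mul_polyC (leq_trans (size_scale_leq _ _)).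
Qed.

Lemma coef_idealS J k c : is_ideal J -> coef_ideal J k c -> coef_ideal J k.+1 c.
Proof.
move=> idJ [f [Jf szf <-]]; exists ('X * f); split; first exact: idealM.
  by rewrite (leq_trans (size_polyMleq _ _)) // size_polyX.
by rewrite coefXM.
Qed.

(** Subtracting a member of [J] with the same leading term lowers the degree. *)
Lemma eq_ideal_coef (J J' : ideal_of {poly R}) :
  is_ideal J -> is_ideal J' -> (forall f, J f -> J' f) ->
  (forall k c, coef_ideal J' k c -> coef_ideal J k c) -> forall f, J' f -> J f.
Proof.
move=> idJ idJ' JJ' coefJ f; have [n] := ubnP (size f).
elim: n f => // n IHn f szf J'f.
have [f0|f0] := eqVneq f 0; first by rewrite f0; apply: ideal0.
have szfS : (size f = (size f).-1.+1)%N by rewrite prednK // size_poly_gt0.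
have [|g [Jg szg gf]] := coefJ (size f).-1 (lead_coef f).
  by exists f; rewrite -szfS.
rewrite -[f](subrK g); apply: idealD => //; apply: IHn; last first.
  by apply: idealB => //; apply: JJ'.
rewrite ltnS in szf; apply: leq_trans szf; rewrite szfS ltnS.
apply/leq_sizeP => j; rewrite leq_eqVlt coefB => /predU1P[<-|ltj].
  by rewrite gf lead_coefE subrr.
have [szfj szgj] : (size f <= j)%N /\ (size g <= j)%N by split; lia.
by rewrite (nth_default _ szfj) (nth_default _ szgj) subrr.
Qed.

(* The diagonal [coef_ideal (J n) n] stabilises at some [N], which settles all
   degrees [k >= N] at once; the finitely many others are treated one by one. *)
Lemma poly_noetherian : noetherian R -> noetherian {poly R}.
Proof.
move=> noethR J idJ incJ.
have monoJ := chain_mono incJ.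
have mono_n k c m n : (m <= n)%N -> coef_ideal (J m) k c -> coef_ideal (J n) k c.
  by move=> le_mn [f [Jf szf fc]]; exists f; split=> //; apply: monoJ Jf.
have mono_k n c k l : (k <= l)%N -> coef_ideal (J n) k c -> coef_ideal (J n) l c.
  apply: (chain_mono (I := fun k => coef_ideal (J n) k)) => {c k l} k c.
  exact: coef_idealS.
have [||N stabN] := noethR (fun n => coef_ideal (J n) n).
- by move=> n; apply: coef_ideal_ideal.
- by move=> n c /(coef_idealS (idJ n)); apply: mono_n.
have [M stabM] : exists M, forall k, (k < N)%N ->
    forall m c, coef_ideal (J m) k c -> coef_ideal (J M) k c.
  elim: (N) => [|K [M IHM]]; first by exists 0%N.
  have [||M' stabM'] := noethR (fun n => coef_ideal (J n) K).
  - by move=> n; apply: coef_ideal_ideal.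
  - by move=> n c; apply: mono_n.
  exists (maxn M M') => k; rewrite ltnS leq_eqVlt => /predU1P[->|ltkK] m c.
    by move/stabM'; apply: mono_n; rewrite leq_maxr.
  by move/(IHM k ltkK); apply: mono_n; rewrite leq_maxl.
exists (maxn M N) => m f Jmf.
apply: (@eq_ideal_coef _ (J (maxn m (maxn M N)))) => //.
- by move=> g; apply: monoJ; rewrite leq_maxr.
- move=> k c; case: (ltnP k N) => [ltkN /(stabM k ltkN)|leNk Jc].
    by apply: mono_n; rewrite leq_maxl.
  (* Raise degree and index to a common value on the diagonal, fall back to [(N, N)], then raise the
     degree to [k] and the index to [maxn M N]. *)
  apply: (mono_n _ _ N); first by rewrite leq_maxr.
  apply: (mono_k _ _ N) => //; apply: (stabN (maxn k (maxn m (maxn M N)))).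
  by apply: mono_n (leq_maxr _ _) _; apply: mono_k (leq_maxl _ _) Jc.
by apply: monoJ Jmf; rewrite leq_maxl.
Qed.
End HilbertBasis.

(** * Transport of ideals and primary components along a ring isomorphism *)

Definition comap_ideal (R S : comNzRingType) (phi : R -> S) (I : ideal_of S) :
  ideal_of R := fun f => I (phi f).

Section Transport.
Variables (R S : comNzRingType) (phi : {rmorphism R -> S}).
Hypothesis phi_bij : bijective phi.
Implicit Types (I J P Q : ideal_of S) (gs : seq R).

Local Notation pull := (comap_ideal phi).

Lemma comap_ideal_eqP I J : ideal_eq (pull I) (pull J) <-> ideal_eq I J.
Proof.
case: phi_bij => psi _ psiK; split=> IJ f; last exact: IJ.
by rewrite -[f]psiK; apply: IJ.
Qed.

Lemma comap_radical I f : radical (pull I) f <-> radical I (phi f).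
Proof. by split=> -[n]; exists n; rewrite /comap_ideal ?rmorphXn // -rmorphXn. Qed.

Lemma comap_primary Q : primary Q -> primary (pull Q).
Proof.
case=> idQ Q1 QM; split.
- split=> [|f g|c f]; rewrite /comap_ideal ?rmorph0 ?rmorphD ?rmorphM.
  + exact: ideal0.
  + exact: idealD.
  + exact: idealM.
- by rewrite /comap_ideal rmorph1.
- by move=> f g; rewrite {1}/comap_ideal rmorphM => /QM[?|?]; [left | right; apply/comap_radical].
Qed.

Lemma comap_primary_component I P Q :
  primary_component_of I P Q ->
  primary_component_of (pull I) (pull P) (pull Q).
Proof.
case=> prQ radQ [n [Qs [prQs IE nIE]]]; split; first exact: comap_primary.
  by move=> f; rewrite comap_radical; apply: radQ.
exists n, (fun i => pull (Qs i)); split=> [i|f|eqI].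
- have [prQi nradQi] := prQs i; split; first exact: comap_primary.
  move=> eqP; apply: nradQi; apply/comap_ideal_eqP => f.
  by rewrite -eqP comap_radical.
- exact: IE.
- by apply: nIE; apply/comap_ideal_eqP.
Qed.

(** An equality of predicates, obtained by extensionality, so that it rewrites inside
    [primary_component_of]. *)
Lemma comap_ideal_gen gs : pull (ideal_gen (map phi gs)) = ideal_gen gs.
Proof.
apply: functional_extensionality => f; apply: propositional_extensionality.
have [_ genD genM] := ideal_gen_ideal gs; have [psi phiK psiK] := phi_bij.
split=> [|genf].
  (* [K] is the image of the ideal under [phi], itself an ideal because [phi] is onto. *)
  pose K f' := exists2 h, phi h = f' & ideal_gen gs h.
  suff KP f' : ideal_gen (map phi gs) f' -> K f'.
    by case/KP=> h /(bij_inj phi_bij)->.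
  apply: ideal_gen_sub; last first.
    by move=> _ /mapP[h hgs ->]; exists h => //; apply: mem_ideal_gen.
  split.
  - by exists 0; [rewrite rmorph0 | apply: ideal0 (ideal_gen_ideal gs)].
  - by move=> _ _ [h <- gh] [k <- gk]; exists (h + k); [rewrite rmorphD | apply: genD].
  - move=> c _ [h <- gh]; exists (psi c * h); last exact: genM.
    by rewrite rmorphM psiK.
apply: ideal_gen_sub genf.
  have [I0 ID IM] := ideal_gen_ideal (map phi gs).
  by split=> [|h k|c h]; rewrite /comap_ideal ?rmorph0 ?rmorphD ?rmorphM //; [apply: ID | apply: IM].
by move=> h hgs; apply: mem_ideal_gen; apply: map_f.
Qed.

Lemma comap_saturation I z : pull (saturation I (phi z)) = saturation (pull I) z.
Proof.
apply: functional_extensionality => f; apply: propositional_extensionality.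
by split=> -[m]; exists m; move: p; rewrite /comap_ideal rmorphM rmorphXn.
Qed.

Lemma comap_ideal_add I J : pull (ideal_add I J) = ideal_add (pull I) (pull J).
Proof.
apply: functional_extensionality => f; apply: propositional_extensionality.
have [psi phiK psiK] := phi_bij.
split=> [[g [h [Ig Jh E]]]|[g [h [Ig Jh ->]]]]; last first.
  by exists (phi g), (phi h); split=> //; rewrite rmorphD.
exists (psi g), (psi h); rewrite /comap_ideal !psiK; split=> //.
by apply: (bij_inj phi_bij); rewrite rmorphD !psiK.
Qed.
End Transport.

(** * Cyclic walks on exponents *)

Lemma coprime_step_ind (D : nat -> Prop) (q N e0 : nat) :
  (0 < q)%N -> coprime q N -> (e0 < N)%N -> D e0 ->
  (forall e, (e < N)%N -> D e -> D ((e + q) %% N)%N) ->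
  forall e, (e < N)%N -> D e.
Proof.
move=> q0 /eqP coqN lt0 D0 Dstep e lte.
have Dt t : D ((e0 + t * q) %% N)%N.
  elim: t => [|t IHt]; first by rewrite addn0 modn_small.
  have ltN : ((e0 + t * q) %% N < N)%N by rewrite ltn_pmod //; lia.
  by have := Dstep _ ltN IHt; rewrite modnDml mulSn [(q + _)%N]addnC addnA.
(* By Bezout [u] steps of length [q] advance by 1 modulo [N], so [(e + (N - e0)) * u] steps lead
   from [e0] to [e]; [N - e0] stands for [- e0]. *)
have [u v uv _] := egcdnP N q0; rewrite coqN in uv.
have := Dt ((e + (N - e0)) * u)%N; rewrite -mulnA uv.
have -> : (e0 + (e + (N - e0)) * (v * N + 1) = ((e + (N - e0)) * v + 1) * N + e)%N.
  by lia.
by rewrite modnMDl modn_small.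
Qed.

Lemma cyclic_relation (R : comNzRingType) (I : ideal_of R) (X Y z : R) (p q a b i : nat) :
  is_ideal I -> I (X ^+ p * z ^+ a - Y ^+ p) -> I (X ^+ q * z ^+ b - Y ^+ q) ->
  (0 < p)%N -> (i < p + q)%N ->
  I ((z ^+ (a * q) - z ^+ (b * p)) * (X ^+ i * Y ^+ (p + q - i.+1))).
Proof.
move=> idI IF IG p0 ltiN; set N := (p + q)%N; pose m k := X ^+ k * Y ^+ (N - k.+1).
(* In a walk of [t] steps of length [q] from [i], [k t] is the position modulo [N] and [w t] the
   number of wraps. A wrap uses the first generator and costs [z^a], any other step uses the second
   and costs [z^b]. *)
pose w t := ((i + t * q) %/ N)%N; pose k t := ((i + t * q) %% N)%N.
have walk t : I (z ^+ (a * w t) * m i - z ^+ (b * (t - w t)) * m (k t)).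
  elim: t => [|t IHt].
    rewrite /w /k addn0 divn_small // modn_small // !muln0 !expr0 subrr.
    exact: ideal0.
  have kE : (i + t * q = w t * N + k t)%N := divn_eq _ _.
  have kN : (k t < N)%N by rewrite ltn_pmod //; lia.
  have wtt : (w t <= t)%N by rewrite -ltnS /w ltn_divLR; lia.
  have E : (i + t.+1 * q = w t * N + (k t + q))%N by lia.
  (* No wrap: [m (k t)] has a factor [Y^q], traded for [X^q z^b]. *)
  case: (ltnP (k t) p) => ktp.
    have wS : w t.+1 = w t by rewrite [LHS]/w E divnMDl ?divn_small ?addn0; lia.
    have kS : k t.+1 = (k t + q)%N by rewrite [LHS]/k E modnMDl modn_small; lia.
    have mkE : m (k t) = X ^+ k t * Y ^+ (N - (k t + q).+1) * Y ^+ q.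
      by rewrite /m -mulrA -exprD; congr (_ * _ ^+ _); lia.
    have mkS : m (k t.+1) = X ^+ k t * X ^+ q * Y ^+ (N - (k t + q).+1).
      by rewrite kS /m exprD.
    rewrite wS (subSn wtt) mkS mulnS exprD; rewrite mkE in IHt.
    set u := z ^+ (b * _) in IHt *.
    rewrite [X in I X](_ : _ = (z ^+ (a * w t) * m i -
        u * (X ^+ k t * Y ^+ (N - (k t + q).+1) * Y ^+ q)) -
      u * X ^+ k t * Y ^+ (N - (k t + q).+1) * (X ^+ q * z ^+ b - Y ^+ q));
      last by ring.
    by apply: idealB => //; apply: idealM.
  (* Wrap: [m (k t)] has a factor [X^p]; after multiplying the relation by [z^a], [X^p z^a] is
     traded for [Y^p]. *)
  have wS : w t.+1 = (w t).+1.
    rewrite [LHS]/w E (_ : (k t + q = N + (k t - p))%N); last by lia.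
    by rewrite addnA -mulSnr divnMDl ?divn_small; lia.
  have kS : k t.+1 = (k t - p)%N.
    rewrite [LHS]/k E (_ : (k t + q = N + (k t - p))%N); last by lia.
    by rewrite addnA -mulSnr modnMDl modn_small; lia.
  have mkE : m (k t) = X ^+ (k t - p) * X ^+ p * Y ^+ (N - (k t).+1).
    by rewrite /m -exprD subnK.
  have mkS : m (k t.+1) = X ^+ (k t - p) * (Y ^+ (N - (k t).+1) * Y ^+ p).
    by rewrite kS /m -exprD; congr (_ * _ ^+ _); lia.
  rewrite wS subSS mkS mulnS exprD; rewrite mkE in IHt.
  set u := z ^+ (b * _) in IHt *.
  rewrite [X in I X](_ : _ = z ^+ a * (z ^+ (a * w t) * m i -
      u * (X ^+ (k t - p) * X ^+ p * Y ^+ (N - (k t).+1))) +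
    u * X ^+ (k t - p) * Y ^+ (N - (k t).+1) * (X ^+ p * z ^+ a - Y ^+ p));
    last by ring.
  by apply: idealD => //; apply: idealM.
(* After [N] steps the walk is back at [i], with [q] wraps and [p] other steps. *)
have := walk N.
have -> : w N = q by rewrite /w mulnC addnC divnMDl ?divn_small ?addn0; lia.
have -> : k N = i by rewrite /k mulnC addnC modnMDl modn_small.
by rewrite -mulrBl /N addnK.
Qed.

(** * Weights and coefficients of nested polynomials *)

(* An element of [T] is read as a polynomial in y over polynomials in x over
   polynomials in z, so that [cf f i j] is the coefficient in F[z] of x^i y^j. *)
Section Core.
Variable F : fieldType.
Local Notation T := {poly {poly {poly F}}}.
Local Notation cf f i j := (f : T)`_j`_i.
Implicit Types (f g : T) (c : {poly F}).

Lemma coef2P f g : (forall i j, cf f i j = cf g i j) -> f = g.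
Proof. by move=> fg; apply/polyP => j; apply/polyP => i; apply: fg. Qed.

Definition mono (p q : nat) c : T := ('X ^+ p)%:P * 'X ^+ q * c%:P%:P.

Lemma cf_mono f p q c i j :
  cf (f * mono p q c) i j =
    if (p <= i)%N && (q <= j)%N then cf f (i - p) (j - q) * c else 0.
Proof.
rewrite /mono !mulrA coefMC coefMXn.
case: (ltnP j q) => [_|_]; first by rewrite mul0r coef0 andbF.
by rewrite coefMC coefMC coefMXn andbT; case: ltnP; rewrite ?mul0r.
Qed.

Lemma cf_const c f i j : cf (c%:P%:P * f) i j = c * cf f i j.
Proof. by rewrite !coefCM. Qed.

Lemma sum_mono f : f = \sum_(j < size f) \sum_(i < size f`_j) mono i j (cf f i j).
Proof.
rewrite -[f in LHS]coefK poly_def; apply: eq_bigr => j _.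
rewrite -[in LHS](coefK f`_j) poly_def -mul_polyC rmorph_sum mulr_suml.
apply: eq_bigr => i _; rewrite /mono -mul_polyC rmorphM /=.
by rewrite -mulrA mulrC.
Qed.

Variables (d l : nat).
Hypotheses (d_gt0 : (0 < d)%N) (l_gt0 : (0 < l)%N).

(** The degree in [X = x^d] and [Y = y^l]: the ring is free over [F[z][X, Y]] on the [x^i0 y^j0]
    with [i0 < d] and [j0 < l], and these basis elements get weight zero. *)
Definition wt i j := (i %/ d + j %/ l)%N.

(** Used with [h = id] as truncation and with [h] a division by [c] as a coefficientwise
    quotient. *)
Definition map_below n (h : {poly F} -> {poly F}) f : T :=
  \poly_(j < size f) \poly_(i < size f`_j)
     (if (wt i j < n)%N then h (cf f i j) else 0).

Lemma cf_map_below n h f i j : h 0 = 0 ->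
  cf (map_below n h f) i j = if (wt i j < n)%N then h (cf f i j) else 0.
Proof.
move=> h0; rewrite coef_poly; case: (ltnP j (size f)) => [_|sz]; last first.
  by rewrite coef0 [f`_j]nth_default // coef0 h0 if_same.
rewrite coef_poly; case: (ltnP i (size f`_j)) => [_ //|sz].
by rewrite [f`_j`_i]nth_default // h0 if_same.
Qed.

(** The generator [X^p z^a - Y^p]; ['X] is [z] here. *)
Definition binom (p a : nat) : T := mono (d * p) 0 'X^a - mono 0 (l * p) 1.

Lemma cf_binom f p a i j :
  cf (f * binom p a) i j =
    (if (d * p <= i)%N then cf f (i - d * p) j * 'X^a else 0)
    - (if (l * p <= j)%N then cf f i (j - l * p) else 0).
Proof. by rewrite mulrBr !coefB !cf_mono !leq0n andbT !subn0 mulr1. Qed.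

(** Multiplication by a binomial keeps the remainders [i0] and [j0], so the coefficient equations
    split into independent systems in the quotients [u] and [v]. *)
Lemma cf_binom_digits f p a i0 j0 u v : (i0 < d)%N -> (j0 < l)%N ->
  cf (f * binom p a) (i0 + d * u) (j0 + l * v) =
    (if (p <= u)%N then cf f (i0 + d * (u - p)) (j0 + l * v) * 'X^a else 0)
    - (if (p <= v)%N then cf f (i0 + d * u) (j0 + l * (v - p)) else 0).
Proof.
have le_digit m k w w' : (k < m)%N -> (m * w <= k + m * w')%N = (w <= w')%N.
  move=> ltkm; apply/idP/idP => [|le_ww']; last by nia.
  by apply: contraTT; rewrite -!ltnNge => ltww'; nia.
move=> lti ltj; rewrite cf_binom !le_digit // !mulnBr.
by congr (_ - _); case: leqP => // le; rewrite addnBA // leq_mul2l le orbT.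
Qed.

Lemma wt_digits i0 j0 u v : (i0 < d)%N -> (j0 < l)%N ->
  wt (i0 + d * u) (j0 + l * v) = (u + v)%N.
Proof.
by move=> lti ltj; rewrite /wt ![(_ * u)%N]mulnC ![(_ * v)%N]mulnC !divnDMl // !divn_small.
Qed.

(** * Divisibility along the cycle of coefficient equations *)

Section Syzygy.
Variables (p q a b : nat) (c : {poly F}).
Hypotheses (p_gt0 : (0 < p)%N) (q_gt0 : (0 < q)%N) (coqN : coprime q (p + q)).
Hypothesis cX : coprimep c 'X.
Variables f g : T.
Hypothesis c_dvd : forall i j, (wt i j < (p + q).-1)%N ->
  c %| cf (f * binom p a + g * binom q b) i j.

(* The equations in weight [n] form a cycle: [edge e] is the coefficient shared by
   those at [x^e y^(n-e)] and at its cyclic predecessor. As [n < p + q - 1], the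
   edge [q - 1] is absent, so that divisibility propagates from [0]. *)
Lemma dvdp_edge (i0 j0 n : nat) (edge := fun e =>
    if (e < q)%N then
      if (e + p <= n)%N then cf f (i0 + d * e) (j0 + l * (n - e - p)) else 0
    else if (e <= n)%N then cf g (i0 + d * (e - q)) (j0 + l * (n - e)) else 0) :
  (i0 < d)%N -> (j0 < l)%N -> (n < (p + q).-1)%N ->
  forall e, (e < p + q)%N -> c %| edge e.
Proof.
move=> lti ltj ltn.
(* As [c] is prime to [z], the powers of [z] in the equations do not affect divisibility by [c]. *)
have dvdX k h : (c %| h * 'X^k) = (c %| h).
  by rewrite Gauss_dvdpl // coprimep_expr.
apply: (coprime_step_ind q_gt0 coqN (e0 := q.-1)); first by lia.
  by rewrite /edge ifT; [rewrite ifF ?dvdp0 //; lia | lia].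
move=> e ltN.
have -> : ((e + q) %% (p + q) = if (e < p)%N then e + q else e - p)%N.
  case: ltnP => [ltep|leep]; first by rewrite modn_small; lia.
  have -> : (e + q = (e - p) + (p + q))%N by lia.
  by rewrite modnDr modn_small; lia.
have := c_dvd (i := i0 + d * e) (j := j0 + l * (n - e)).
rewrite wt_digits // !coefD !cf_binom_digits //.
(* For [e > n] there is no monomial [x^e y^(n-e)], and the next edge is zero by definition. *)
case: (leqP e n) => [leen|ltne _ _]; last first.
  case: ltnP => [ltep|leep]; rewrite /edge.
    by rewrite ifF; [rewrite ifF ?dvdp0 //; lia | lia].
  by rewrite ifT; [rewrite ifF ?dvdp0 //; lia | lia].
rewrite subnKC // => /(_ ltn).
have -> : (p <= n - e)%N = (e + p <= n)%N by lia.
have -> : (q <= n - e)%N = (e + q <= n)%N by lia.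
rewrite /edge (ltnNge e q) (leqNgt p e) leen.
(* The equation at [e] has just two terms left, edge [e] (from [f] if [e < q], else from [g]) and
   the next edge (from [g] if [e < p], else from [f]). *)
case: (ltnP e p) => [ltep|leep]; case: (leqP q e) => [leeq|lteq] /=.
- have -> : (e + q < q)%N = false by lia.
  have -> : (e + p <= n)%N = false by lia.
  rewrite addnK subnDA !sub0r oppr0 add0r => H H'; move: H.
  by rewrite dvdp_subr // dvdX.
- have -> : (e + q < q)%N = false by lia.
  by rewrite addnK [in X in _ -> X]subnDA !sub0r => H H'; move: H; rewrite dvdp_addr ?dvdpNr.
- have -> : (e - p < q)%N by lia.
  have -> : (e + p <= n)%N = false by lia.
  have -> : (e + q <= n)%N = false by lia.
  have -> : (n - (e - p) - p = n - e)%N by lia.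
  rewrite subnK // leen !subr0 => H H'; move: H.
  by rewrite dvdp_addl ?dvdX.
- have -> : (e - p < q)%N by lia.
  have -> : (e + q <= n)%N = false by lia.
  have -> : (n - (e - p) - p = n - e)%N by lia.
  rewrite subnK // leen subr0 addr0 => H H'; move: H.
  by rewrite dvdp_subl ?dvdX.
Qed.

(** With [u] and [v] the quotients of [i] and [j], the coefficient of [f] is edge [u] in weight
    [u + v + p], that of [g] is edge [u + q] in weight [u + v + q]; the bounds keep these weights
    below [p + q - 1]. *)
Lemma syzygy_dvdp i j :
  ((wt i j < q.-1)%N -> c %| cf f i j) /\ ((wt i j < p.-1)%N -> c %| cf g i j).
Proof.
have [lti ltj] : (i %% d < d)%N /\ (j %% l < l)%N by rewrite !ltn_pmod.
have iE : (i %% d + d * (i %/ d))%N = i by rewrite addnC mulnC -divn_eq.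
have jE : (j %% l + l * (j %/ l))%N = j by rewrite addnC mulnC -divn_eq.
rewrite /wt; move: iE jE; set u := (i %/ d)%N; set v := (j %/ l)%N => iE jE.
split=> lt_uv.
  have := dvdp_edge lti ltj (n := (u + v + p)%N) _ (e := u).
  rewrite ifT; last by lia.
  rewrite ifT; last by lia.
  have -> : (u + v + p - u - p = v)%N by lia.
  by rewrite iE jE; apply; lia.
have := dvdp_edge lti ltj (n := (u + v + q)%N) _ (e := (u + q)%N).
rewrite ifF; last by lia.
rewrite ifT; last by lia.
have -> : (u + v + q - (u + q) = v)%N by lia.
by rewrite addnK iE jE; apply; lia.
Qed.
End Syzygy.

(** * Monomials of high weight, and cancelling [c] in low weight *)

Lemma mono_mul i j i' j' c c' :
  mono i j c * mono i' j' c' = mono (i + i') (j + j') (c * c').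
Proof. by rewrite /mono !exprD !rmorphM /=; ring. Qed.

Lemma mono0 i j : mono i j 0 = 0.
Proof. by rewrite /mono !polyC0 mulr0. Qed.

Lemma mono_exp i j c n : mono i j c ^+ n = mono (i * n) (j * n) (c ^+ n).
Proof. by rewrite /mono !exprMn -!polyC_exp -!exprM. Qed.

Lemma mono_z : mono 0 0 'X = 'X%:P%:P.
Proof. by rewrite /mono !expr0 polyC1 !mul1r. Qed.

Lemma binomE p a :
  binom p a = mono d 0 1 ^+ p * 'X%:P%:P ^+ a - mono 0 l 1 ^+ p.
Proof.
rewrite -mono_z !mono_exp mono_mul !mul0n !addn0 !expr1n mul1r.
by [].
Qed.

(** A monomial of weight at least [n] is divisible by some [X^k Y^(n-k)]; [k] is taken as large as
    possible. *)
Lemma high_weight_mem (J : ideal_of T) n h : is_ideal J ->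
  (forall k, (k <= n)%N -> J (mono (d * k) (l * (n - k)) 1)) ->
  (forall i j, (wt i j < n)%N -> cf h i j = 0) -> J h.
Proof.
move=> idJ Jmono hlow; rewrite (sum_mono h); apply: ideal_sum => // j.
apply: ideal_sum => // i; case: (ltnP (wt i j) n) => [/hlow->|lewt].
  by rewrite mono0; apply: ideal0.
pose k := minn n (i %/ d).
have lei : (d * k <= i)%N.
  by rewrite (leq_trans _ (leq_trunc_div i d)) // mulnC leq_mul2r geq_minr orbT.
have lej : (l * (n - k) <= j)%N.
  rewrite (leq_trans _ (leq_trunc_div j l)) // mulnC leq_mul2r; apply/orP; right.
  by move: lewt; rewrite /wt /k; move: (i %/ d)%N (j %/ l)%N => u v; lia.
have -> : mono i j (cf h i j) =
    mono (i - d * k) (j - l * (n - k)) (cf h i j) * mono (d * k) (l * (n - k)) 1.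
  by rewrite mono_mul mulr1 !subnK.
by apply: idealM => //; apply: Jmono; rewrite geq_minl.
Qed.

Lemma ideal_gen_high_weight n gs h :
  {in gs, forall g, exists2 k, (k <= n)%N & g = mono (d * k) (l * (n - k)) 1} ->
  ideal_gen gs h -> forall i j, (wt i j < n)%N -> cf h i j = 0.
Proof.
move=> gsP [e ->] i j ltn; rewrite !coef_sum; apply: big1 => m _.
have [k lekn ->] := gsP _ (mem_nth 0 (ltn_ord m)).
rewrite cf_mono; case: ifP => // /andP[lei lej]; move: ltn.
have lei' : (k <= i %/ d)%N by rewrite leq_divRL // mulnC.
have lej' : (n - k <= j %/ l)%N by rewrite leq_divRL // mulnC.
by rewrite /wt; move: (i %/ d)%N (j %/ l)%N lei' lej' => u v; lia.
Qed.

(** The binomial is homogeneous of weight [p], so truncating [f] below [n] truncates the product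
    below [n + p]. *)
Lemma cf_divp_binom n c f p a i j :
  (forall i j, (wt i j < n)%N -> c %| cf f i j) ->
  c * cf (map_below n (fun h => h %/ c) f * binom p a) i j =
    if (wt i j < n + p)%N then cf (f * binom p a) i j else 0.
Proof.
move=> c_dvd.
have divcK i' j' : c * cf (map_below n (fun h => h %/ c) f) i' j' =
    if (wt i' j' < n)%N then cf f i' j' else 0.
  rewrite cf_map_below ?div0p //; case: ifP; last by rewrite mulr0.
  by move=> ltn; rewrite mulrC divpK // c_dvd.
have wtX : (d * p <= i)%N -> wt i j = (wt (i - d * p) j + p)%N.
  by move=> le; rewrite /wt -{1}(subnKC le) [(d * p)%N]mulnC divnMDl // -addnA addnC.
have wtY : (l * p <= j)%N -> wt i j = (wt i (j - l * p) + p)%N.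
  by move=> le; rewrite /wt -{1}(subnKC le) [(l * p)%N]mulnC divnMDl // addnCA addnC.
rewrite !cf_binom mulrBr.
rewrite [c * (if _ then _ * _ else _)](_ : _ = if (wt i j < n + p)%N then
  if (d * p <= i)%N then cf f (i - d * p) j * 'X^a else 0 else 0); last first.
  case: (leqP (d * p) i) => [le|_]; last by rewrite mulr0 if_same.
  by rewrite mulrA divcK (wtX le) ltn_add2r; case: ifP => // _; rewrite mul0r.
rewrite [c * _](_ : _ = if (wt i j < n + p)%N then
  if (l * p <= j)%N then cf f i (j - l * p) else 0 else 0); last first.
  case: (leqP (l * p) j) => [le|_]; last by rewrite mulr0 if_same.
  by rewrite divcK (wtY le) ltn_add2r.
by case: ifP; rewrite ?subr0.
Qed.

Lemma low_weight_torsion p q a b c f A B :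
  (0 < p)%N -> (0 < q)%N -> coprime q (p + q) -> c != 0 ->
  (forall i j, (wt i j < (p + q).-1)%N ->
     c * cf f i j = cf (A * binom p a + B * binom q b) i j) ->
  exists m A' B', ('X%:P%:P) ^+ m * map_below (p + q).-1 id f =
                  A' * binom p a + B' * binom q b.
Proof.
(* Splits [c = c' z^m] with [c'] prime to [z]: the multiplicity of the root 0 is the exponent of
   [z]. *)
move=> p0 q0 coqN c0 E; have [m [c' + cE]] := multiplicity_XsubC c 0.
rewrite c0 /= -coprimep_XsubC polyC0 subr0 => c'X.
rewrite polyC0 subr0 in cE.
have c'0 : c' != 0 by apply: contraNneq c0 => c'0; rewrite cE c'0 mul0r.
have c'_dvd i j : (wt i j < (p + q).-1)%N ->
    c' %| cf (A * binom p a + B * binom q b) i j.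
  by move/E<-; rewrite cE -mulrA dvdp_mulr.
have AB i j := syzygy_dvdp p0 q0 coqN c'X c'_dvd i j.
exists m, (map_below q.-1 (fun h => h %/ c') A), (map_below p.-1 (fun h => h %/ c') B).
(* Both truncated products end at the same weight [p + q - 1], so their sum is the truncation of the
   whole combination. *)
have qp : (q.-1 + p = (p + q).-1)%N by lia.
have pq : (p.-1 + q = (p + q).-1)%N by lia.
apply: coef2P => i j; apply: (mulfI c'0).
rewrite -!rmorphXn /= cf_const coefD coefD mulrDr cf_map_below //.
rewrite !cf_divp_binom; [|by move=> u v; case: (AB u v)..].
rewrite qp pq; case: ifP => ltN; last by rewrite !mulr0 addr0.
by rewrite mulrA -cE E // !coefD.
Qed.

(** * The primary component in nested polynomials *)

Section Main.
Variables (p q a b : nat).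
Hypotheses (p_gt0 : (0 < p)%N) (q_gt0 : (0 < q)%N) (coqN : coprime q (p + q)).
Hypothesis neq_slope : (a * q != b * p)%N.
Local Notation N := (p + q)%N.
Local Notation I := (ideal_gen [:: binom p a; binom q b]).
Local Notation P := (ideal_gen [:: mono 1 0 1; mono 0 1 1]).
Local Notation gens := [seq mono (k * d) (l * (N - k.+1)) 1 | k <- iota 0 N].
Local Notation z := ('X%:P%:P : T).

Lemma gens_spec : {in gens, forall g, exists2 k, (k <= N.-1)%N &
  g = mono (d * k) (l * (N.-1 - k)) 1}.
Proof.
move=> g /mapP[k]; rewrite mem_iota => /andP[_ ltk] ->; exists k; first by lia.
by rewrite mulnC; congr (mono _ (_ * _) _); lia.
Qed.

Lemma mem_gens k : (k <= N.-1)%N -> mono (d * k) (l * (N.-1 - k)) 1 \in gens.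
Proof.
move=> lek; apply/mapP; exists k; first by rewrite mem_iota; lia.
by rewrite mulnC; congr (mono _ (_ * _) _); lia.
Qed.

Lemma cf00M f g : cf (f * g) 0 0 = cf f 0 0 * cf g 0 0.
Proof. by rewrite !coef0M. Qed.

(** [P] is the kernel of setting [x = y = 0], so it is prime because [F[z]] is a domain. *)
Lemma ideal_xyP f : P f <-> cf f 0 0 = 0.
Proof.
split=> [/ideal_gen2P[A [B ->]]|f0]; first by rewrite coefD coefD !cf_mono addr0.
have idP := ideal_gen_ideal [:: mono 1 0 1; mono 0 1 1].
suff Pmono i j c : (i = 0%N -> j = 0%N -> c = 0) -> P (mono i j c).
  rewrite (sum_mono f); apply: ideal_sum => // j; apply: ideal_sum => // i.
  by apply: Pmono => -> ->.
move=> c0; case: (posnP i) => [i0|i_gt0].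
  case: (posnP j) => [j0|j_gt0].
    by rewrite c0 // mono0; apply: ideal0.
  have -> : mono i j c = mono i j.-1 c * mono 0 1 1 by rewrite mono_mul addn0 addn1 prednK ?mulr1.
  by apply: idealM => //; apply: mem_ideal_gen; rewrite !inE eqxx orbT.
have -> : mono i j c = mono i.-1 j c * mono 1 0 1 by rewrite mono_mul addn0 addn1 prednK ?mulr1.
by apply: idealM => //; apply: mem_ideal_gen; rewrite !inE eqxx.
Qed.

(** The extreme generators, [k = N - 1] and [k = 0], are pure powers of [x] and [y]. *)
Lemma radical_gens f : P f -> radical (ideal_gen gens) f.
Proof.
apply: ideal_gen_sub; first exact/radical_ideal/ideal_gen_ideal.
move=> g; rewrite !inE => /predU1P[->|/eqP->].
  exists (d * N.-1)%N; apply: mem_ideal_gen; rewrite mono_exp mul1n mul0n expr1n.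
  by have := mem_gens (leqnn _); rewrite subnn muln0.
exists (l * N.-1)%N; apply: mem_ideal_gen; rewrite mono_exp mul1n mul0n expr1n.
by have := mem_gens (leq0n _); rewrite subn0 muln0.
Qed.

Lemma primary_component_poly :
  primary_component_of I P (ideal_add (saturation I z) (ideal_gen gens)).
Proof.
have idI := ideal_gen_ideal [:: binom p a; binom q b].
have idP := ideal_gen_ideal [:: mono 1 0 1; mono 0 1 1].
have idM := ideal_gen_ideal gens; have idS := saturation_ideal z idI.
have zC m : z ^+ m = ('X^m)%:P%:P by rewrite -!rmorphXn.
apply: localization_primary_component => //.
- by do 3!apply: poly_noetherian; apply: field_noetherian.
- split=> // [/ideal_xyP|f g /ideal_xyP].
    by rewrite !coef1 => /eqP; rewrite oner_eq0.
  by rewrite cf00M => /eqP; rewrite mulf_eq0 => /orP[]/eqP/ideal_xyP; [left | right].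
- move=> f /ideal_gen2P[A [B ->]]; apply/ideal_xyP.
  have pos m n : (0 < m)%N -> (0 < n)%N -> (m * n <= 0)%N = false by case: m n => [|m] [].
  by rewrite coefD coefD !cf_binom !pos // subr0 addr0.
- move=> f; split=> [[g [h [[m Ig] Mh ->]]]|[u [Pu Iuf]]].
    (* The multiplier of the cyclic relation; it is outside [P] because [a q] and [b p] differ. *)
    pose u : T := z ^+ (a * q) - z ^+ (b * p).
    have Iuh : I (u * h).
      have idu : is_ideal (fun h => I (u * h)).
        split=> [|h1 h2 I1 I2|c h1 I1]; rewrite ?mulr0 ?mulrDr 1?mulrCA.
        - exact: ideal0.
        - exact: idealD.
        - exact: idealM.
      apply: (ideal_gen_sub idu) Mh => g' /mapP[k]; rewrite mem_iota => /andP[_ ltk] ->.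
      have -> : mono (k * d) (l * (N - k.+1)) 1 =
          mono d 0 1 ^+ k * mono 0 l 1 ^+ (N - k.+1).
        by rewrite !mono_exp mono_mul !mul0n !expr1n mulr1 addn0 mulnC.
      by apply: cyclic_relation => //; rewrite -binomE; apply: mem_ideal_gen;
        rewrite !inE eqxx ?orbT.
    exists (z ^+ m * u); split.
      rewrite ideal_xyP /u !zC cf00M !coefB !coefC /= => /eqP; rewrite mulf_eq0 expf_eq0 polyX_eq0 andbF /=.
      move/eqP/polyP/(_ (a * q)%N)/eqP; rewrite coefB !coefXn eqxx coef0 (negPf neq_slope) subr0.
      by rewrite oner_eq0.
    have -> : z ^+ m * u * (g + h) = u * (z ^+ m * g) + z ^+ m * (u * h) by ring.
    by apply: idealD => //; apply: idealM.
  (* [c - u] is in [P], so one of its powers lies in the ideal of [gens]. *)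
  pose c := cf u 0 0; have c0 : c != 0 by apply/eqP => /ideal_xyP.
  have [L ML] : radical (ideal_gen gens) (c%:P%:P - u).
    by apply/radical_gens/ideal_xyP; rewrite !coefB !coefC subrr.
  (* [c^L - (c - u)^L] is a multiple of [u], and [u f] is in [I]. *)
  have [A [B E]] : exists A B, c%:P%:P ^+ L * f - (c%:P%:P - u) ^+ L * f
      = A * binom p a + B * binom q b.
    apply/ideal_gen2P; rewrite -mulrBl subrXX opprB addrCA subrr addr0.
    by rewrite mulrAC mulrC; apply: idealM.
  have cL0 : c ^+ L != 0 by rewrite expf_neq0.
  have [|m [A' [B' E']]] :=
      @low_weight_torsion p q a b (c ^+ L) f A B p_gt0 q_gt0 coqN cL0.
    (* [(c - u)^L f] has no monomial of weight below [N - 1], so there [c^L f] agrees with an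
       element of [I]. *)
    move=> i j ltN; rewrite -E -!rmorphXn /= !coefB cf_const.
    have Mf : ideal_gen gens ((c%:P%:P - u) ^+ L * f) by rewrite mulrC; apply: idealM.
    by rewrite (ideal_gen_high_weight gens_spec Mf) // subr0.
  (* The low-weight part of [f] goes to the saturation, the rest to the ideal of [gens]. *)
  exists (map_below N.-1 id f), (f - map_below N.-1 id f); split.
  - by exists m; apply/ideal_gen2P; exists A', B'.
  - apply: (high_weight_mem (n := N.-1)) => // [k lek|i j ltN].
      exact/mem_ideal_gen/mem_gens.
    by rewrite !coefB cf_map_below // ltN subrr.
  - by rewrite addrC subrK.
- move=> f /radical_gens[n Mn]; exists n, 0, (f ^+ n); rewrite add0r.
  by split=> //; apply: ideal0.
Qed.
End Main.
End Core.

(** * The isomorphism between multivariate and nested polynomials *)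

Section NestedPoly.
Variable F : fieldType.
Local Notation T := {poly {poly {poly F}}}.
Local Notation M := {mpoly F[3]}.

Definition nested_var (i : 'I_3) : T := nth 0 [:: 'X%:P; 'X; 'X%:P%:P] i.

Definition nest : {rmorphism M -> T} :=
  mmap (polyC \o polyC \o polyC : {rmorphism F -> T}) nested_var.

Lemma nestE p : nest p =
  \sum_(m <- msupp p) (p@_m)%:P%:P%:P * \prod_(i < 3) nested_var i ^+ m i.
Proof. by []. Qed.

Lemma nestC c : nest c%:MP = c%:P%:P%:P.
Proof. by rewrite /nest /= mmapC. Qed.

Lemma nestX i : nest 'X_i = nested_var i.
Proof. by rewrite /nest /= mmapX mmap1U. Qed.

Lemma unnest_exists : exists u : {rmorphism T -> M},
  (forall c, u c%:P%:P%:P = c%:MP) /\ (forall i, u (nested_var i) = 'X_i).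
Proof.
pose u2 : {rmorphism {poly F} -> M} :=
  horner_morph (fun c => mulrC ('X_2 : M) (mpolyC 3 c)).
pose u1 : {rmorphism {poly {poly F}} -> M} :=
  horner_morph (fun c => mulrC ('X_0 : M) (u2 c)).
pose u : {rmorphism T -> M} := horner_morph (fun c => mulrC ('X_1 : M) (u1 c)).
have uC c : u c%:P = u1 c by apply: horner_morphC.
have u1C c : u1 c%:P = u2 c by apply: horner_morphC.
have u2C c : u2 c%:P = c%:MP by apply: horner_morphC.
have uX : u 'X = 'X_1 by apply: horner_morphX.
have u1X : u1 'X = 'X_0 by apply: horner_morphX.
have u2X : u2 'X = 'X_2 by apply: horner_morphX.
exists u; split=> [c|i]; first by rewrite uC u1C u2C.
have [->|[->|->]] : i = 0 \/ i = 1 \/ i = 2.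
  by case: i => [[|[|[|//]]] lti]; [left|right; left|right; right]; apply: val_inj.
- by rewrite /nested_var /= uC u1X.
- by rewrite /nested_var /= uX.
- by rewrite /nested_var /= uC u1C u2X.
Qed.

(** Both composites are ring morphisms fixing constants and variables; on the nested side the
    induction peels off [y], then [x], then [z]. *)
Lemma nest_bij : bijective nest.
Proof.
have [u [uC uX]] := unnest_exists.
exists u => [p|f].
  rewrite nestE rmorph_sum [RHS]mpolyE; apply: eq_bigr => m _.
  rewrite rmorphM uC mul_mpolyC mpolyXE_id rmorph_prod.
  by congr (_ *: _); apply: eq_bigr => i _; rewrite rmorphXn /= uX.
have nuC c : nest (u c%:P%:P%:P) = c%:P%:P%:P by rewrite uC nestC.
have nuX i : nest (u (nested_var i)) = nested_var i by rewrite uX nestX.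
elim/poly_ind: f => [|f g IHf]; first by rewrite !rmorph0.
rewrite !rmorphD !rmorphM IHf (nuX 1); congr (_ + _).
elim/poly_ind: g => [|g h IHg]; first by rewrite !rmorph0.
rewrite !rmorphD !rmorphM IHg (nuX 0); congr (_ + _).
elim/poly_ind: h => [|h c IHh]; first by rewrite !rmorph0.
by rewrite !rmorphD !rmorphM IHh (nuX 2) nuC.
Qed.
End NestedPoly.

(** * Consequences of the conditions on [B], and the conclusion *)

(** [l] is [lam * d], an integer since Bezout writes [d] as an integer combination of [r] and [s],
    and [lam r], [lam s] are integers. *)
Lemma truncn_Bmat (r s a b : nat) (lam : rat) :
  0 < lam -> Bmat r s a b lam \is a mxOver Num.int -> (0 < r)%N ->
  exists2 l, (0 < l)%N & forall k, Num.truncn (lam * (gcdn r s * k)%:R) = (l * k)%N.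
Proof.
move=> lam0 /mxOverP Bint r0.
have r_int : lam * r%:R \in Num.int by have := Bint 1 0; rewrite mxE /= rpredN.
have s_int : lam * s%:R \in Num.int by have := Bint 1 1; rewrite mxE /= rpredN.
have d_int : lam * (gcdn r s)%:R \in Num.int.
  have [u v uv _] := egcdnP s r0.
  have -> : (gcdn r s)%:R = u%:R * r%:R - v%:R * s%:R :> rat.
    by rewrite -!natrM uv natrD addrC addKr.
  by rewrite mulrBr ![lam * (_ * _)]mulrCA rpredB // rpredM // intr_nat.
have d_gt0 : 0 < lam * (gcdn r s)%:R by rewrite mulr_gt0 // ltr0n gcdn_gt0 r0.
have : lam * (gcdn r s)%:R \is a Num.nat by rewrite natrEint d_int ltW.
case/natrP => l lE; exists l; first by rewrite -(ltr0n rat) -lE.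
by move=> k; rewrite natrM mulrA lE -natrM natrK.
Qed.

(** From [a s <= b s <= b r], equality of the ends forces [r = s] and [a = b]; the columns of [B]
    then coincide and [(1, -1)] kills its transpose. *)
Lemma Bmat_rank_slope (r s a b : nat) (lam : rat) :
  (0 < r)%N -> (0 < s)%N -> (0 < b)%N -> (a <= b)%N -> (s <= r)%N ->
  \rank (Bmat r s a b lam) = 2%N -> (a * s != b * r)%N.
Proof.
move=> r0 s0 b0 leab lesr rkB; apply/eqP => slope.
have [rs ab] : r = s /\ a = b by split; nia.
have freeB : row_free (Bmat r s a b lam)^T by rewrite -row_leq_rank mxrank_tr rkB.
pose v : 'rV[rat]_2 := \row_j (-1) ^+ j.
have : v *m (Bmat r s a b lam)^T = 0.
  apply/rowP => i; rewrite !mxE big_ord_recl big_ord1 !mxE /= rs ab.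
  by case: i => [[|[|[|//]]] lti] /=; rewrite ?expr0 ?expr1 mul1r mulN1r subrr.
move/eqP; rewrite mulmx_free_eq0 // => /eqP/rowP/(_ 0).
by rewrite !mxE expr0 => /eqP; rewrite oner_eq0.
Qed.

(* x = 'X_0, y = 'X_1, z = 'X_2 in {mpoly K[3]};
   lam * n is the (integer) exponent λ n, read as a nat via Num.truncn. *)
Theorem theorem4p7 (K : closedFieldType) (hK : [pchar K] =i pred0)
    (r s a b : nat) (lam : rat)
    (hr : (0 < r)%N) (hs : (0 < s)%N) (ha : (0 < a)%N) (hb : (0 < b)%N)
    (hab : (a <= b)%N) (hrs : (s <= r)%N) (hlam : 0 < lam)
    (hBint : Bmat r s a b lam \is a mxOver Num.int)
    (hBrank : \rank (Bmat r s a b lam) = 2%N) :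
  let d := gcdn r s in
  let e (n : nat) : nat := Num.truncn (lam * n%:R) in
  let x : {mpoly K[3]} := 'X_0 in
  let y : {mpoly K[3]} := 'X_1 in
  let z : {mpoly K[3]} := 'X_2 in
  let IB := ideal_gen [:: x ^+ r * z ^+ a - y ^+ e r; x ^+ s * z ^+ b - y ^+ e s] in
  primary_component_of IB (ideal_gen [:: x; y])
    (ideal_add (saturation IB z)
       (ideal_gen [seq x ^+ (k * d)%N * y ^+ e (r + s - k.+1 * d)%N
                  | k <- iota 0 ((r + s) %/ d)%N])).
Proof.
move=> d e x y z IB.
have [l l0 eE] := truncn_Bmat hlam hBint hr.
have slope := Bmat_rank_slope hr hs hb hab hrs hBrank.
have d0 : (0 < d)%N by rewrite gcdn_gt0 hr.
pose p := (r %/ d)%N; pose q := (s %/ d)%N.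
have rE : r = (d * p)%N by rewrite mulnC divnK ?dvdn_gcdl.
have sE : s = (d * q)%N by rewrite mulnC divnK ?dvdn_gcdr.
have p0 : (0 < p)%N by move: hr; rewrite rE muln_gt0 => /andP[].
have q0 : (0 < q)%N by move: hs; rewrite sE muln_gt0 => /andP[].
have copq : coprime q (p + q).
  rewrite /coprime gcdnDr gcdnC -(eqn_pmul2l d0) muln_gcdr -rE -sE muln1.
  by [].
have neq : (a * q != b * p)%N.
  by apply: contraNneq slope => E; rewrite sE rE !(mulnCA _ d) E.
(* Every exponent of [y] is [e] of a multiple of [d], so no truncation actually occurs. *)
have eEd k : e (d * k)%N = (l * k)%N by apply: eE.
have nest_mono i j : nest K (x ^+ i * y ^+ j) = mono i j 1.
  by rewrite rmorphM !rmorphXn !nestX /mono !polyC1 mulr1 polyC_exp.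
have nest_binom k c : nest K (x ^+ (d * k) * z ^+ c - y ^+ (l * k)) = binom K d l k c.
  rewrite rmorphB rmorphM !rmorphXn !nestX binomE /mono !expr0 !polyC1 !mulr1 mul1r.
  by rewrite !exprM polyC_exp.
have gensE : [seq mono (k * d) (l * (p + q - k.+1)) (1 : {poly K}) | k <- iota 0 (p + q)] =
    map (nest K) [seq x ^+ (k * d)%N * y ^+ e (r + s - k.+1 * d)%N
                  | k <- iota 0 ((r + s) %/ d)%N].
  rewrite -map_comp divnDl ?dvdn_gcdl //; apply: eq_map => k /=.
  by rewrite nest_mono -eEd; congr (mono _ (e _) _); rewrite mulnBr mulnDr -rE -sE mulnC.
(* The nested result is pulled back along [nest]; what remains is to match the generators. *)
have := comap_primary_component (nest_bij K)
  (primary_component_poly K d0 l0 p0 q0 copq neq).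
rewrite (comap_ideal_add (nest_bij K)) gensE (comap_ideal_gen (nest_bij K)).
have -> : 'X%:P%:P = nest K z by rewrite nestX.
rewrite comap_saturation.
have -> : [:: binom K d l p a; binom K d l q b] =
    map (nest K) [:: x ^+ r * z ^+ a - y ^+ e r; x ^+ s * z ^+ b - y ^+ e s].
  by rewrite /= -!nest_binom -!eEd -rE -sE.
have -> : [:: mono 1 0 (1 : {poly K}); mono 0 1 1] = map (nest K) [:: x; y].
  by rewrite /= !nestX /mono /= !expr0 !expr1 !polyC1 !mulr1 mul1r.
by rewrite !(comap_ideal_gen (nest_bij K)).
Qed.
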